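(* Let $f:\mathbb{R}^n\times\mathbb{R}\to\mathbb{R}^n$ be $C^1$, let $\lambda_-<\lambda_+$ and let $\Lambda$ be a parameter shift from $\lambda_-$ to $\lambda_+$. For $r>0$ let $\Phi$ be the solution cocycle of $\dot x=f(x,\Lambda(rt))$, and for fixed $\lambda$ let $\phi_\lambda$ be the flow of $\dot x=f(x,\lambda)$. Suppose $\lambda\mapsto A(\lambda)$, $\lambda\in[\lambda_-,\lambda_+]$, is a branch of attractors that is uniformly stable, and set $A_\pm=A(\lambda_\pm)$. For $r>0$, $\eta>0$ and $t\in\mathbb{R}$ define the pullback attractor fibres $$A_t^{[\Lambda,r,A_-]}:=\bigcap_{\tau>0}\overline{\bigcup_{s\le-\tau}\Phi\big(t,s,\mathcal{N}_{\eta}(A_-)\big)},$$ with $\eta>0$ sufficiently small that this set does not depend on $\eta$. Then for all $\epsilon>0$ there exists $\delta>0$ such that $$d\big(A_t^{[\Lambda,r,A_-]},A(\Lambda(rt))\big)<\epsilon$$ for all $0<r<\delta$ and all $t\in\mathbb{R}$. Moreover, there is $\delta>0$ such that for all $0<r<\delta$ there is tracking, i.e. $A_{+\infty}^{[\Lambda,r,A_-]}\subset A_+$, where $A_{+\infty}^{[\Lambda,r,A_-]}=\bigcap_{\tau>0}\overline{\bigcup_{t\ge\tau}A_t^{[\Lambda,r,A_-]}}$.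
   Context: A parameter shift from $\lambda_-$ to $\lambda_+$ is a smooth $\Lambda:\mathbb{R}\to(\lambda_-,\lambda_+)$ with $\lim_{\tau\to\pm\infty}\Lambda(\tau)=\lambda_\pm$ and $\lim_{\tau\to\pm\infty}\Lambda'(\tau)=0$. Solutions are assumed to exist for all time; $\Phi(t,s,x_0)$ is the value at time $t$ of the solution with $x(s)=x_0$. For nonempty compact $X,Y\subset\mathbb{R}^n$, $d(X,Y)=\sup_{x\in X}\inf_{y\in Y}\|x-y\|$, $d_H(X,Y)=\max\{d(X,Y),d(Y,X)\}$, and $\mathcal{N}_\eta(M)=\{x:d(x,M)<\eta\}$. A connected compact $\phi_\lambda$-invariant set $M$ is an exponentially stable attractor if there are $\mu>0$, $\eta>0$, $C\ge1$ with $d(\phi_\lambda(t,x),M)\le Ce^{-\mu t}d(x,M)$ for all $x\in\mathcal{N}_\eta(M)$ and $t>0$. A branch of attractors is a map $\lambda\mapsto A(\lambda)$, continuous with respect to $d_H$, such that each $A(\lambda)$ is an exponentially stable attractor of $\phi_\lambda$; it is uniformly stable if the constants $\mu,\eta,C$ can be chosen independent of $\lambda\in[\lambda_-,\lambda_+]$. (Since $A_-$ is in particular asymptotically stable for $\phi_{\lambda_-}$, the fibres defined in the claim are independent of $\eta$ for all sufficiently small $\eta>0$.) *)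

(* Defs.v *)
From HB Require Import structures.
From mathcomp Require Import all_boot all_order all_algebra.
From mathcomp Require Import all_classical all_reals all_analysis.
Set Implicit Arguments. Unset Strict Implicit. Unset Printing Implicit Defensive.
Import Order.TTheory GRing.Theory Num.Theory.
Import numFieldNormedType.Exports.
Local Open Scope classical_set_scope.
Local Open Scope ring_scope.

Section Defs.
Variables (R : realType) (n : nat).
Local Notation V := 'rV[R]_n.

(* f : R^n x R -> R^n is C^1: differentiable everywhere, and the derivative
   p |-> Df(p) is continuous (in finite dimension: continuity of p |-> Df(p) v
   for every direction v). *)
Definition C1 (f : V * R -> V) : Prop :=
  (forall p, differentiable f p) /\ (forall v : V * R, continuous (fun p => 'd f p v)).

Definition smooth (g : R -> R) : Prop :=
  forall (k : nat) (x : R), derivable (derive1n k g) x 1.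

Definition parameter_shift (Lam : R -> R) (lm lp : R) : Prop :=
  smooth Lam /\ (forall tau, lm < Lam tau < lp) /\
  (Lam x @[x --> -oo] --> lm) /\ (Lam x @[x --> +oo] --> lp) /\
  ((derive1 Lam) x @[x --> -oo] --> 0) /\ ((derive1 Lam) x @[x --> +oo] --> 0).

(* d(x, M) = inf_{y in M} ||x - y||  (extended reals; +oo if M empty) *)
Definition dist_pt (x : V) (M : set V) : \bar R :=
  ereal_inf [set (`|x - y|)%:E | y in M].

Definition dist (X Y : set V) : \bar R :=
  ereal_sup [set dist_pt x Y | x in X].

Definition dist_H (X Y : set V) : \bar R := maxe (dist X Y) (dist Y X).

Definition nbhd_set (eta : R) (M : set V) : set V :=
  [set x | (dist_pt x M < eta%:E)%E].

Definition is_flow (f : V * R -> V) (l : R) (phi : R -> V -> V) : Prop :=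
  forall x, phi 0 x = x /\ forall t, is_derive (t : R) (1 : R) (fun u => phi u x) (f (phi t x, l)).

Definition is_cocycle (f : V * R -> V) (Lam : R -> R) (r : R)
  (Phi : R -> R -> V -> V) : Prop :=
  forall s x0, Phi s s x0 = x0 /\
    forall t, is_derive (t : R) (1 : R) (fun u => Phi u s x0) (f (Phi t s x0, Lam (r * t))).

Definition invariant (phi : R -> V -> V) (M : set V) : Prop :=
  forall t, phi t @` M = M.

Definition exp_stable_with (phi : R -> V -> V) (M : set V) (mu eta C : R) : Prop :=
  0 < mu /\ 0 < eta /\ 1 <= C /\
  forall x t, nbhd_set eta M x -> 0 < t ->
    (dist_pt (phi t x) M <= (C * expR (- (mu * t)))%:E * dist_pt x M)%E.

Definition attractor_set (phi : R -> V -> V) (M : set V) : Prop :=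
  M !=set0 /\ compact M /\ connected M /\ invariant phi M.

Definition exp_stable_attractor (phi : R -> V -> V) (M : set V) : Prop :=
  attractor_set phi M /\ exists mu eta C, exp_stable_with phi M mu eta C.

Definition branch_of_attractors (phi : R -> R -> V -> V) (A : R -> set V)
  (lm lp : R) : Prop :=
  (forall l0, lm <= l0 <= lp -> forall e, 0 < e -> exists2 d, 0 < d &
     forall l, lm <= l <= lp -> `|l - l0| < d -> (dist_H (A l) (A l0) < e%:E)%E) /\
  (forall l, lm <= l <= lp -> exp_stable_attractor (phi l) (A l)).

Definition uniformly_stable_branch (phi : R -> R -> V -> V) (A : R -> set V)
  (lm lp : R) : Prop :=
  branch_of_attractors phi A lm lp /\
  exists mu eta C, forall l, lm <= l <= lp -> exp_stable_with (phi l) (A l) mu eta C.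

Definition pullback_fibre (Phi : R -> R -> V -> V) (Am : set V) (eta t : R) : set V :=
  \bigcap_(tau in [set tau : R | 0 < tau])
    closure (\bigcup_(s in [set s : R | s <= - tau]) (Phi t s @` nbhd_set eta Am)).

Definition pullback_limit (Phi : R -> R -> V -> V) (Am : set V) (eta : R) : set V :=
  \bigcap_(tau in [set tau : R | 0 < tau])
    closure (\bigcup_(t in [set t : R | tau <= t]) pullback_fibre Phi Am eta t).

End Defs.

(* Main.v *)
(** On a time window of fixed length T, a solution of x' = f(x, Lam(r t)) stays
    close to the solution of the system frozen at the parameter value at the
    start of the window, as soon as Lam(r t) varies little over the window.
    Choosing T with C exp(-mu T) <= 1/2, the frozen flow halves the distance to
    the attractor over one window, so that the distance D_k to the moving
    attractor after k windows satisfies D_{k+1} <= D_k / 2 + 2 rho, and D_k is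
    eventually of order rho.  Small r makes rho small uniformly in time, which
    gives the first claim; for the second one, the variation of Lam(r t) over a
    window tends to 0 as t -> +oo for every fixed r, so that rho can be taken
    arbitrarily small at late times. *)
Require Import Defs.
From HB Require Import structures.
From mathcomp Require Import all_boot all_order all_algebra.
From mathcomp Require Import all_classical all_reals all_analysis.
From mathcomp Require Import ring lra.
Import Order.TTheory GRing.Theory Num.Theory.
Import numFieldNormedType.Exports.
Local Open Scope classical_set_scope.
Local Open Scope ring_scope.
Set Implicit Arguments. Unset Strict Implicit. Unset Printing Implicit Defensive.

(** * Neighbourhoods of sets and the distance to a set *)

Lemma nbhd_setP (R : realType) (n : nat) (c : R) (M : set 'rV[R]_n)
    (x : 'rV[R]_n) :
  nbhd_set c M x <-> exists2 y, M y & `|x - y| < c.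
Proof.
split=> [/ereal_inf_lt[_ [y My <-]]|[y My xy]].
  by rewrite lte_fin => ?; exists y.
apply: (@le_lt_trans _ _ (`|x - y|)%:E); last by rewrite lte_fin.
by apply: ereal_inf_lbound; exists y.
Qed.

Lemma nbhd_set_le (R : realType) (n : nat) (c d : R) (M : set 'rV[R]_n) :
  c <= d -> nbhd_set c M `<=` nbhd_set d M.
Proof. by move=> cd x /lt_le_trans; apply; rewrite lee_fin. Qed.

Lemma nbhd_set_ball (R : realType) (n : nat) (c d : R) (M : set 'rV[R]_n)
    (x y : 'rV[R]_n) :
  nbhd_set c M x -> `|y - x| < d -> nbhd_set (c + d) M y.
Proof.
move=> /nbhd_setP[z Mz xz] yx; apply/nbhd_setP; exists z => //.
rewrite -(subrKA x) addrC (le_lt_trans (ler_normD _ _))//.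
by rewrite ltrD.
Qed.

Lemma dist_H_nbhd_set (R : realType) (n : nat) (d : R) (M N : set 'rV[R]_n) :
  (dist_H M N < d%:E)%E -> M `<=` nbhd_set d N /\ N `<=` nbhd_set d M.
Proof.
rewrite gt_max => /andP[MN NM]; split=> x ?.
  by apply: le_lt_trans MN; apply: ereal_sup_ubound; exists x.
by apply: le_lt_trans NM; apply: ereal_sup_ubound; exists x.
Qed.

Lemma nbhd_set_trans (R : realType) (n : nat) (c d : R) (M N : set 'rV[R]_n) :
  M `<=` nbhd_set d N -> nbhd_set c M `<=` nbhd_set (c + d) N.
Proof.
move=> MN x /nbhd_setP[y /MN Ny xy]; rewrite addrC.
exact: nbhd_set_ball Ny xy.
Qed.

Lemma dist_pt_fin_num (R : realType) (n : nat) (M : set 'rV[R]_n)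
    (x : 'rV[R]_n) : M !=set0 -> dist_pt x M \is a fin_num.
Proof.
move=> [y My]; rewrite ge0_fin_numE.
  by apply: le_lt_trans (ereal_inf_lbound _) (ltry `|x - y|); exists y.
by apply: le_ereal_inf_tmp => _ [z _ <-]; rewrite lee_fin.
Qed.

(** At [t = 0], which [exp_stable_with] does not cover, [C >= 1] suffices. Nonemptiness of [M] makes
    the distance finite, so the strict bound survives multiplication. *)
Lemma exp_stable_nbhd_set (R : realType) (n : nat)
    (phi : R -> 'rV[R]_n -> 'rV[R]_n) (M : set 'rV[R]_n) (mu eta C c t : R)
    (x : 'rV[R]_n) :
  M !=set0 -> phi 0 x = x -> exp_stable_with phi M mu eta C -> c <= eta ->
  0 <= t -> nbhd_set c M x ->
  nbhd_set (C * expR (- (mu * t)) * c) M (phi t x).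
Proof.
move=> M0 phi0 [mu0 [eta0 [C1 stab]]] ce; rewrite le_eqVlt => /predU1P[<-|t0] Mx.
  rewrite phi0 mulr0 oppr0 expR0 mulr1; apply: (nbhd_set_le _ Mx).
  have /nbhd_setP[y _ /(le_lt_trans (normr_ge0 _)) c0] := Mx.
  by rewrite ler_peMl// ltW.
have := stab x t (nbhd_set_le ce Mx) t0.
move: Mx; rewrite /nbhd_set /= -(fineK (dist_pt_fin_num x M0)).
rewrite lte_fin => xc /le_lt_trans; apply; rewrite -EFinM lte_fin.
by rewrite ltr_pM2l// mulr_gt0 ?expR_gt0// (lt_le_trans _ C1).
Qed.

(** This is the sublevel set d(x, M) <= c in terms of open neighbourhoods. A bound on orbits passes
    to the closures in a pullback fibre when it is stated as membership in a closed set. *)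
Lemma closed_dist_pt_le (R : realType) (n : nat) (M : set 'rV[R]_n) (c : R) :
  closed [set x | forall d, c < d -> nbhd_set d M x].
Proof.
move=> x clx d cd; pose e := (d - c) / 2.
have e0 : 0 < e by rewrite /e; lra.
have [y [Ny]] := clx _ (nbhsx_ballx x e e0).
rewrite -ball_normE /= => xy.
have -> : d = (c + e) + e by rewrite /e; lra.
by apply: (nbhd_set_ball _ xy); apply: Ny; lra.
Qed.

Lemma closed_nbhd_set0 (R : realType) (n : nat) (M : set 'rV[R]_n)
    (x : 'rV[R]_n) :
  closed M -> (forall d, 0 < d -> nbhd_set d M x) -> M x.
Proof.
move=> clM Mx; apply: clM => U /nbhs_ballP[e /= e0 eU].
have /nbhd_setP[y My xy] := Mx e e0; exists y; split=> //.
by apply: eU; rewrite -ball_normE.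
Qed.

(** * Compactness of the parameter interval *)

(** If y is within d/2 of x and z within d/2 of y, both are within d of x; compactness then makes d
    uniform. This serves the uniform continuity of both the branch and [Lam]. *)
Lemma segment_lebesgue_number (R : realType) (a b : R) (Q : R -> R -> Prop) :
  (forall x, a <= x <= b -> exists2 d, 0 < d &
     forall y z, a <= y <= b -> a <= z <= b ->
       `|y - x| < d -> `|z - x| < d -> Q y z) ->
  exists2 d, 0 < d &
    forall y z, a <= y <= b -> a <= z <= b -> `|y - z| < d -> Q y z.
Proof.
move=> locQ.
have /compact_near_coveringP/near_covering_withinP cov := @segment_compact R a b.
pose P (d y : R) := forall z, a <= z <= b -> `|y - z| < d -> Q y z.
have [|d /= d0 dP] := cov R 0^'+ P _ _.
  move=> x; rewrite /= in_itv /= => /locQ[d d0 dQ].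
  exists (ball x (d / 2), [set e | 0 < e < d / 2]).
    split; first by apply: nbhsx_ballx; rewrite divr_gt0.
    exists (d / 2); first by rewrite /= divr_gt0.
    by move=> e /=; rewrite sub0r normrN => ed e0; rewrite e0 (le_lt_trans (ler_norm _)).
  move=> [y e] /= [xy /andP[e0 ed]]; rewrite in_itv /= => yab z zab yz.
  move: xy; rewrite -ball_normE /= distrC => xy.
  have h : d / 2 < d by lra.
  apply: dQ => //; first exact: lt_trans xy h.
  rewrite -(subrKA y) (le_lt_trans (ler_normD _ _))// [d]splitr ltrD//.
  by rewrite distrC (lt_trans yz).
exists (d / 2); first by rewrite divr_gt0.
move=> y z yab; apply: (dP (d / 2)) => //=; rewrite ?in_itv//.
  by rewrite sub0r normrN gtr0_norm ?divr_gt0//; lra.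
by rewrite divr_gt0.
Qed.

(** Near each [l0] the set [A l] lies within distance 1 of the bounded set [A l0]; compactness of
    [a, b] makes the bound uniform. *)
Lemma segment_bounded_family (R : realType) (n : nat) (a b : R)
    (A : R -> set 'rV[R]_n) :
  (forall l, a <= l <= b -> compact (A l)) ->
  (forall l0, a <= l0 <= b -> forall e, 0 < e -> exists2 d, 0 < d &
     forall l, a <= l <= b -> `|l - l0| < d -> (dist_H (A l) (A l0) < e%:E)%E) ->
  exists B, forall l x, a <= l <= b -> A l x -> `|x| <= B.
Proof.
move=> cptA contA.
have /compact_near_coveringP/near_covering_withinP cov := @segment_compact R a b.
have [|B [_ BP]] := cov R +oo (fun B l => forall x, A l x -> `|x| <= B) _ _.
  move=> l0; rewrite /= in_itv /= => l0ab.
  have [d d0 dA] := contA _ l0ab 1 ltr01.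
  have [B [_ AB]] := compact_bounded (cptA _ l0ab).
  exists (ball l0 d, [set e | B + 2 < e]).
    by split; [exact: nbhsx_ballx|exists (B + 2); split => //; exact: num_real].
  move=> [l e] /= []; rewrite -ball_normE /= distrC => ll0 Be.
  rewrite in_itv /= => lab x Alx.
  have [/(_ _ Alx)/nbhd_setP[y Ay xy] _] := dist_H_nbhd_set (dA _ lab ll0).
  rewrite -(subrK y x) (le_trans (ler_normD _ _))//.
  have := AB (B + 1) _ y Ay; rewrite ltrDl ltr01 => /(_ isT) /=; lra.
exists (B + 1) => l x lab; apply: (BP (B + 1)) => /=; last by rewrite in_itv.
by rewrite ltrDl.
Qed.

(** * Lipschitz bounds for C^1 fields on bounded sets *)

Lemma coord_le_mx_norm (R : realType) (n : nat) (x : 'rV[R]_n) (j : 'I_n) :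
  `|x ord0 j| <= `|x|.
Proof.
rewrite [leRHS]/Num.Def.normr/= mx_normrE.
exact: (le_bigmax _ (fun i : 'I_1 * 'I_n => `|x i.1 i.2|) (ord0, j)).
Qed.

Lemma mx_norm_le (R : realType) (n : nat) (x : 'rV[R]_n) (c : R) :
  0 <= c -> (forall j, `|x ord0 j| <= c) -> `|x| <= c.
Proof.
move=> c0 xc; rewrite /Num.Def.normr/= mx_normrE bigmax_le//= => -[i j] _ /=.
by rewrite ord1.
Qed.

Lemma is_derive_coord (R : realType) (n : nat) (y : R -> 'rV[R]_n) (t : R)
    (dy : 'rV[R]_n) (j : 'I_n) :
  is_derive t 1 y dy -> is_derive t 1 (fun u => y u ord0 j) (dy ord0 j).
Proof.
move=> [dery <-]; split; first exact: (derivable_mxP _ _ _).1.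
by rewrite derive_mx// mxE.
Qed.

Lemma prod_norm_le (R : realType) (n : nat) (p : 'rV[R]_n * R) (c : R) :
  (`|p| <= c) = (`|p.1| <= c) && (`|p.2| <= c).
Proof. by rewrite [`|p|]prod_normE ge_max. Qed.

Lemma compact_prod_norm_ball (R : realType) (n : nat) (M : R) :
  compact [set p : 'rV[R]_n * R | `|p| <= M].
Proof.
rewrite (_ : [set p | _] = [set x : 'rV[R]_n | `|x| <= M] `*` `[- M, M]).
  apply: compact_setX (@segment_compact _ _ _); apply: bounded_closed_compact.
    exists M; split; first exact: num_real.
    by move=> e Me x /= xM; rewrite (le_trans xM)// ltW.
  have -> : [set x : 'rV[R]_n | `|x| <= M] = Num.norm @^-1` [set z | z <= M] by [].
  by apply: closed_comp (@closed_le _ M) => x _; exact: norm_continuous.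
by apply/seteqP; split=> -[x l] /=; rewrite prod_norm_le in_itv /= -ler_norml => /andP.
Qed.

(** [C1] gives continuity of the derivative one direction at a time, so each of the n + 1 basis
    directions is bounded separately on the compact ball, and linearity assembles the bounds. *)
Lemma C1_diff_bounded (R : realType) (n : nat) (f : 'rV[R]_n * R -> 'rV[R]_n)
    (M : R) :
  C1 f -> exists2 L, 0 <= L & forall p v, `|p| <= M -> `|'d f p v| <= L * `|v|.
Proof.
move=> [df cdf].
have bnd (v : 'rV[R]_n * R) :
    exists2 B, 0 <= B & forall p, `|p| <= M -> `|'d f p v| <= B.
  have [|B [_ dB]] := @compact_bounded R 'rV[R]_n ((fun p => 'd f p v) @`
      [set p : 'rV[R]_n * R | `|p| <= M]).
    apply: continuous_compact (@compact_prod_norm_ball _ _ _).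
    exact/continuous_subspaceT/cdf.
  exists (Num.max 0 (B + 1)); first by rewrite le_max lexx.
  move=> p pM; rewrite le_max; apply/orP; right.
  by apply: dB => /=; [rewrite ltrDl|exists p].
have [B0 B00 dB0] := bnd (0, 1).
pose e (j : 'I_n) : 'rV[R]_n * R := (delta_mx ord0 j, 0).
pose B j := s2val (cid2 (bnd (e j))).
have B_ge0 j : 0 <= B j := s2valP (cid2 (bnd (e j))).
have dB j p : `|p| <= M -> `|'d f p (e j)| <= B j :=
  s2valP' (cid2 (bnd (e j))) p.
exists (\sum_j B j + B0); first by rewrite addr_ge0// sumr_ge0.
move=> p v pM.
have vE : v = \sum_j v.1 ord0 j *: e j + v.2 *: (0, 1).
  apply/pair_eqP => /=; apply/andP; split; apply/eqP.
    rewrite /= scaler0 addr0 (raddf_sum (@fst _ _ : {additive _ -> _})) /=.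
    exact: row_sum_delta.
  rewrite (raddf_sum (@snd _ _)) /= big1 ?add0r => [|j _]; last by rewrite scaler0.
  by rewrite [RHS]mulr1.
have [v1 v2] : `|v.1| <= `|v| /\ `|v.2| <= `|v|.
  by apply/andP; rewrite -prod_norm_le.
rewrite [X in 'd f p X]vE linearD linear_sum linearZ /= mulrDl mulr_suml.
rewrite (le_trans (ler_normD _ _))// lerD//.
  rewrite (le_trans (ler_norm_sum _ _ _))// ler_sum// => j _.
  rewrite linearZ /= normrZ mulrC ler_pM// ?dB//.
  exact: le_trans (coord_le_mx_norm _ _) v1.
by rewrite normrZ mulrC ler_pM// dB0.
Qed.

(** The mean value theorem is scalar, so it is applied to each coordinate along the segment from q
    to p, which stays in the ball by convexity. With the sup norm the same [L] serves all
    coordinates. *)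
Lemma C1_lipschitz (R : realType) (n : nat) (f : 'rV[R]_n * R -> 'rV[R]_n)
    (M : R) :
  C1 f -> exists2 L, 0 <= L &
    forall p q : 'rV[R]_n * R, `|p| <= M -> `|q| <= M -> `|f p - f q| <= L * `|p - q|.
Proof.
move=> C1f; have [L L0 dL] := C1_diff_bounded M C1f; exists L => // p q pM qM.
apply: mx_norm_le => [|j]; first by rewrite mulr_ge0.
pose g (u : R) := q + u *: (p - q).
have dg (u : R) : is_derive u (1 : R) (f \o g) ('d f (g u) (p - q)).
  have difg : differentiable g u by [].
  have diff : differentiable f (g u) by case: C1f.
  split; first exact/diff_derivable/differentiable_comp.
  rewrite deriveE; last exact: differentiable_comp.
  rewrite diff_comp//=; congr ('d f _ _).
  have Dg : is_diff u g (cst 0 + ( *:%R^~ (p - q))) by exact: is_diffD.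
  by rewrite diff_val /= add0r scale1r.
pose h (u : R) := (f \o g) u ord0 j.
have dh (u : R) : is_derive u (1 : R) h ('d f (g u) (p - q) ord0 j).
  exact: is_derive_coord.
have [|u u01] := MVT ltr01 (fun u _ => dh u).
  apply: derivable_within_continuous => u _; exact: (@ex_derive _ _ _ _ _ _ _ (dh u)).
rewrite /h /= /g scale1r scale0r addr0 subrKC subr0 mulr1 !mxE => ->.
apply: le_trans (coord_le_mx_norm _ _) (dL _ _ _).
have -> : q + u *: (p - q) = (1 - u) *: q + u *: p.
  by rewrite scalerBr scalerBl scale1r addrA addrAC.
move: u01; rewrite in_itv /= => /andP[u0 u1].
rewrite (le_trans (ler_normD _ _))// !normrZ !gtr0_norm// ?subr_gt0//.
have -> : M = (1 - u) * M + u * M by ring.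
by rewrite lerD// ler_wpM2l// ?subr_ge0 ltW.
Qed.

(** The function E(u) exp(-K u) has nonpositive derivative. *)
Lemma gronwall (R : realType) (K T : R) (E dE : R -> R) :
  (forall u : R, is_derive u (1 : R) E (dE u)) ->
  (forall u : R, 0 <= u < T -> dE u <= K * E u) ->
  0 <= T -> E T <= E 0 * expR (K * T).
Proof.
move=> derE leE T0; pose g (u : R) := E u * expR (- K * u).
have dg (u : R) : is_derive u (1 : R) g
    (dE u * expR (- K * u) - K * E u * expR (- K * u)).
  have dexp : is_derive u (1 : R) (fun u : R => expR (- K * u)) (- K * expR (- K * u)).
    have dlin : is_derive u (1 : R) (fun u : R => - K * u) (- K).
      apply: (is_derive_eq (is_deriveZ (- K) (is_derive_id u (1 : R)))).
      by rewrite /GRing.scale /= mulr1.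
    by apply: (is_derive_eq (is_derive1_comp (is_derive_expR _) dlin)); rewrite mulrC.
  have := is_deriveM (derE u) dexp.
  by move/is_derive_eq; apply; rewrite /GRing.scale /=; ring.
have gT : g T <= g 0.
  apply: (@ler0_derive1_le_cc _ g 0 T); rewrite ?in_itv /= ?lexx ?T0//.
  - move=> u; rewrite in_itv /= => /andP[u0 uT]; rewrite derive1E derive_val.
    by rewrite -mulrBl pmulr_lle0 ?expR_gt0// subr_le0 leE// uT ltW.
  - apply: derivable_within_continuous => u _.
    exact: (@ex_derive _ _ _ _ _ _ _ (dg u)).
move: gT; rewrite /g mulr0 expR0 mulr1 mulNr expRN.
by rewrite ler_pdivrMr ?expR_gt0.
Qed.

(** By compactness there would be a least time in [0, t] with [rho <= g u], which contradicts
    [step]. At time 0 the premise of [step] is vacuous, so [step] also supplies the initial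
    bound. *)
Lemma first_exit (R : realType) (g : R -> R) (T rho : R) :
  continuous g ->
  (forall t : R, 0 <= t <= T -> (forall u : R, 0 <= u < t -> g u < rho) -> g t < rho) ->
  forall t : R, 0 <= t <= T -> g t < rho.
Proof.
move=> cg step t /andP[t0 tT]; rewrite ltNge; apply/negP => gt.
pose S := `[0, t] `&` [set u | rho <= g u].
have [|||u] := @compact_EVT_min R R id S.
- by exists t; split=> //=; rewrite in_itv /= t0 lexx.
- apply: compact_closedI; first exact: segment_compact.
  exact: closed_comp (fun x _ => cg x) (@closed_ge _ rho).
- by apply: continuous_subspaceT => x.
rewrite inE /S /= in_itv /= => -[/andP[u0 ut] gu] umin.
suff : g u < rho by rewrite ltNge gu.
apply: step => [|v /andP[v0 vu]]; first by rewrite u0 (le_trans ut).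
rewrite ltNge; apply/negP => gv; suff : u <= v by rewrite leNgt vu.
apply: umin; rewrite inE.
by split => //=; rewrite in_itv /= v0 (le_trans (ltW vu)).
Qed.

(** A bootstrap: [f] is Lipschitz only on the ball of radius [M], and [y] is known to lie there only
    while it is within [rho] of [z]. [first_exit] permits assuming this closeness before time t when
    proving it at t. *)
Lemma solution_near_frozen_solution (R : realType) (n : nat)
    (f : 'rV[R]_n * R -> 'rV[R]_n) (M L l0 T rho kappa s : R) (lam : R -> R)
    (y z : R -> 'rV[R]_n) :
  0 <= L ->
  (forall p q : 'rV[R]_n * R, `|p| <= M -> `|q| <= M ->
     `|f p - f q| <= L * `|p - q|) ->
  (forall t : R, is_derive t (1 : R) y (f (y t, lam t))) ->
  (forall t : R, is_derive t (1 : R) z (f (z t, l0))) ->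
  y s = z 0 -> 0 < kappa -> `|l0| <= M ->
  kappa * expR (3 * n%:R * L * T) < rho ->
  (forall u : R, 0 <= u <= T ->
     [/\ `|z u| <= M - rho, `|lam (s + u)| <= M & `|lam (s + u) - l0| < kappa]) ->
  forall u : R, 0 <= u <= T -> `|y (s + u) - z u| < rho.
Proof.
(* Each of the n coordinates adds at most 2 L |w| (|w| + kappa) to the derivative of the sum of
   squares, and 2 |w| kappa <= |w|^2 + kappa^2; this gives the factor 3 n L. *)
move=> L0 lipf dy dz yz k0 l0M krho box; set K := 3 * n%:R * L.
have K0 : 0 <= K by rewrite !mulr_ge0.
pose w u := y (s + u) - z u.
pose dw u := f (y (s + u), lam (s + u)) - f (z u, l0).
have dwj j (u : R) : is_derive u (1 : R) (fun v => w v ord0 j) (dw u ord0 j).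
  have ds : is_derive u (1 : R) (fun u : R => s + u) (1 : R).
    apply: (is_derive_eq
      (is_deriveD (is_derive_cst s u (1 : R)) (is_derive_id u (1 : R)))).
    by rewrite add0r.
  have dyj := is_derive1_comp (is_derive_coord j (dy (s + u))) ds.
  have -> : (fun v => w v ord0 j) =
      (fun v => y v ord0 j) \o (fun u => s + u) - (fun v => z v ord0 j).
    by apply/funext => v; rewrite /w !mxE.
  apply: (is_derive_eq (is_deriveB dyj (is_derive_coord j (dz u)))).
  by rewrite mulr1 /dw !mxE.
have cw : continuous (fun u => `|w u|).
  move=> u; apply: continuous_comp; last exact: norm_continuous.
  have cy t : {for t, continuous y}.
    exact/differentiable_continuous/derivable1_diffP/(@ex_derive _ _ _ _ _ _ _ (dy t)).
  apply: continuousB.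
    apply: continuous_comp (cy _).
    by apply: continuousD; [exact: cst_continuous|exact: id].
  exact/differentiable_continuous/derivable1_diffP/(@ex_derive _ _ _ _ _ _ _ (dz u)).
(* The sup norm is not differentiable, so Gronwall is applied to the sum of squares. *)
pose S u := \sum_j w u ord0 j ^+ 2.
have wS u : `|w u| ^+ 2 <= S u.
  have S0 : 0 <= S u by apply: sumr_ge0 => j _; exact: sqr_ge0.
  rewrite -[leRHS]sqr_sqrtr// ler_pXn2r ?nnegrE ?sqrtr_ge0//.
  apply: mx_norm_le => [|j]; first exact: sqrtr_ge0.
  rewrite -sqrtr_sqr ler_wsqrtr// /S (bigD1 j)//= lerDl.
  by apply: sumr_ge0 => i _; exact: sqr_ge0.
apply: first_exit cw _ => t /andP[t0 tT] wlt.
(* The summand kappa^2 absorbs the parameter error, which makes the differential inequality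
   homogeneous. *)
pose E u := S u + kappa ^+ 2.
pose dE u := \sum_j (2 * w u ord0 j * dw u ord0 j).
have derE (u : R) : is_derive u (1 : R) E (dE u).
  have -> : E = \sum_j (fun v => w v ord0 j) ^+ 2 + cst (kappa ^+ 2).
    by apply/funext => v; rewrite /E /S [RHS]/= fct_sumE.
  have dsum := is_derive_sum (fun j => is_deriveX 2 (dwj j u)).
  apply: (is_derive_eq (is_deriveD dsum (is_derive_cst _ _ _))).
  rewrite addr0; apply: eq_bigr => j _.
  by rewrite /GRing.scale /= expr1.
have leE (u : R) : 0 <= u < t -> dE u <= K * E u.
  move=> /andP[u0 ut].
  have [|zM lM lk] := box u; first by rewrite u0 (le_trans (ltW ut)).
  have wu : `|w u| < rho by apply: wlt; rewrite u0.
  have dwu : `|dw u| <= L * (`|w u| + kappa).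
    apply: le_trans (lipf _ _ _ _) _; rewrite ?prod_norm_le /=.
    - rewrite lM andbT -(subrK (z u) (y _)) (le_trans (ler_normD _ _))//.
      by rewrite -/(w u); lra.
    - by rewrite l0M andbT; have := normr_ge0 (w u); lra.
    - rewrite ler_wpM2l// prod_norm_le /= -/(w u) lerDl (ltW k0)/=.
      by rewrite (le_trans (ltW lk))// lerDr.
  have dEn : dE u <= \sum_(j < n) (2 * `|w u| * (L * (`|w u| + kappa))).
    apply: ler_sum => j _; rewrite -!mulrA ler_wpM2l//.
    rewrite (le_trans (ler_norm _))// normrM ler_pM// ?coord_le_mx_norm//.
    exact: le_trans (coord_le_mx_norm _ _) dwu.
  apply: le_trans dEn _; rewrite sumr_const card_ord -[leLHS]mulr_natl /K /E.
  have -> : n%:R * (2 * `|w u| * (L * (`|w u| + kappa))) =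
    n%:R * L * (2 * `|w u| ^+ 2 + 2 * (`|w u| * kappa)) by ring.
  have -> : 3 * n%:R * L * (S u + kappa ^+ 2) = n%:R * L * (3 * (S u + kappa ^+ 2)).
    by ring.
  rewrite ler_wpM2l ?mulr_ge0//.
  have := wS u; have := sqr_ge0 (`|w u| - kappa).
  by have := sqr_ge0 kappa; rewrite sqrrB; lra.
have := gronwall derE leE t0.
have -> : E 0 = kappa ^+ 2.
  rewrite /E /S big1 ?add0r// => j _.
  by rewrite /w addr0 yz subrr mxE expr0n.
move=> Et; rewrite -/(w t) -(ltr_pXn2r (n := 2)) ?nnegrE//; last first.
  by rewrite (le_trans _ (ltW krho))// mulr_ge0 ?expR_ge0// ltW.
(* As exp(K T) >= 1, it may be replaced by its square, so that the hypothesis on [kappa] applies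
   without a square root. *)
have : kappa ^+ 2 * expR (K * t) <= (kappa * expR (K * T)) ^+ 2.
  rewrite exprMn ler_wpM2l ?sqr_ge0// expr2 (@le_trans _ _ (expR (K * T)))//.
    by rewrite ler_expR ler_wpM2l.
  rewrite ler_peMl ?expR_ge0// -expR0 ler_expR mulr_ge0//.
  exact: le_trans tT.
have : (kappa * expR (K * T)) ^+ 2 < rho ^+ 2.
  rewrite ltr_pXn2r ?nnegrE// ?mulr_ge0 ?expR_ge0 ?(ltW k0)//.
  by rewrite (le_trans _ (ltW krho))// mulr_ge0 ?expR_ge0// ltW.
have := wS t; have := sqr_ge0 kappa; move: Et; rewrite /E; lra.
Qed.

(** * The moving attractor over slow windows *)

Lemma branch_uniformly_continuous (R : realType) (n : nat)
    (phi : R -> R -> 'rV[R]_n -> 'rV[R]_n) (A : R -> set 'rV[R]_n)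
    (lm lp e : R) :
  branch_of_attractors phi A lm lp -> 0 < e -> exists2 d, 0 < d &
    forall l l', lm <= l <= lp -> lm <= l' <= lp -> `|l - l'| < d ->
      A l `<=` nbhd_set e (A l').
Proof.
move=> [contA _] e0; apply: segment_lebesgue_number => l0 l0I.
have e20 : 0 < e / 2 by rewrite divr_gt0.
have [d d0 dA] := contA _ l0I _ e20; exists d => // l l' lI l'I ll0 l'l0 x Ax.
have [/(_ _ Ax) A0x _] := dist_H_nbhd_set (dA _ lI ll0).
have [_ AA] := dist_H_nbhd_set (dA _ l'I l'l0).
by rewrite [e]splitr; exact: nbhd_set_trans AA _ A0x.
Qed.

Lemma nbhd_set_slow_window (R : realType) (n : nat)
    (f : 'rV[R]_n * R -> 'rV[R]_n) (lm lp : R)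
    (phi : R -> R -> 'rV[R]_n -> 'rV[R]_n) (A : R -> set 'rV[R]_n)
    (mu eta C T rho : R) :
  C1 f -> (forall l, lm <= l <= lp -> is_flow f l (phi l)) ->
  branch_of_attractors phi A lm lp ->
  (forall l, lm <= l <= lp -> exp_stable_with (phi l) (A l) mu eta C) ->
  0 < rho ->
  exists2 kappa, 0 < kappa &
    forall (lam : R -> R) (y : R -> 'rV[R]_n) (s c : R),
      (forall t, lm <= lam t <= lp) ->
      (forall t : R, is_derive t (1 : R) y (f (y t, lam t))) ->
      (forall u, 0 <= u <= T -> `|lam (s + u) - lam s| < kappa) ->
      c <= eta -> nbhd_set c (A (lam s)) (y s) ->
      forall u, 0 <= u <= T ->
        nbhd_set (C * expR (- (mu * u)) * c + 2 * rho) (A (lam (s + u)))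
          (y (s + u)).
Proof.
move=> C1f flow brA stab rho0.
have [dA dA0 unifA] := branch_uniformly_continuous brA rho0.
have [contA attrA] := brA.
have [B AB] : exists B, forall l x, lm <= l <= lp -> A l x -> `|x| <= B.
  by apply: segment_bounded_family contA => l /attrA[[_ []]].
pose M := `|B| + `|C * eta| + rho + `|lm| + `|lp|.
have [L L0 lipf] := C1_lipschitz M C1f.
pose K := 3 * n%:R * L.
have kK : 0 < rho / 2 / expR (K * T) by rewrite !divr_gt0 ?expR_gt0.
(* The first entry controls the motion of the attractor; the second, multiplied by exp(K T), is rho
   / 2 < rho. *)
exists (Num.min dA (rho / 2 / expR (K * T))); first by rewrite lt_min dA0.
move=> lam y s c lamI dy osc ceta ys u uT.
pose l0 := lam s; have l0I : lm <= l0 <= lp by exact: lamI.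
have lamM t : `|lam t| <= `|lm| + `|lp|.
  have /andP[lt tl] := lamI t; rewrite ler_norml; apply/andP; split.
    by have := ler_norm (- lm); rewrite normrN; have := normr_ge0 lp; lra.
  by have := ler_norm lp; have := normr_ge0 lm; lra.
have [[A0 _] _] := attrA _ l0I.
have [phi0 dphi] := flow _ l0I (y s).
have [mu0 [eta0 [C1 _]]] := stab _ l0I.
have c0 : 0 < c by have /nbhd_setP[a _ /(le_lt_trans (normr_ge0 _))] := ys.
have phiN v : 0 <= v ->
    nbhd_set (C * expR (- (mu * v)) * c) (A l0) (phi l0 v (y s)).
  by move=> v0; exact: exp_stable_nbhd_set A0 phi0 (stab _ l0I) ceta v0 ys.
have close : `|y (s + u) - phi l0 u (y s)| < rho.
  move: u uT; apply: (@solution_near_frozen_solution _ _ f M L l0 T rho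
    (rho / 2 / expR (K * T)) s lam y (phi l0 ^~ (y s))) => //.
  - have := lamM s; rewrite /M /l0; have := normr_ge0 B.
    by have := normr_ge0 (C * eta); lra.
  - by rewrite divfK ?gt_eqF ?expR_gt0//; lra.
  - move=> v vT; split.
    + have /andP[v0 _] := vT.
      have /nbhd_setP[a Aa za] := phiN v v0.
      have aB := AB _ _ l0I Aa.
      have : C * expR (- (mu * v)) * c <= C * eta.
        rewrite -mulrA ler_wpM2l ?(le_trans _ C1)// -[leRHS]mul1r.
        rewrite ler_pM ?expR_ge0 ?(ltW c0)// -expR0 ler_expR oppr_le0.
        by rewrite mulr_ge0// ltW.
      have : `|phi l0 v (y s)| <= `|phi l0 v (y s) - a| + `|a|.
        by rewrite -{1}(subrK a (phi _ _ _)) ler_normD.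
      have := ler_norm B; have := ler_norm (C * eta).
      have := normr_ge0 lm; have := normr_ge0 lp; rewrite /M; lra.
    + have := lamM (s + v); rewrite /M; have := normr_ge0 B.
    by have := normr_ge0 (C * eta); lra.
    + by have := osc v vT; rewrite lt_min => /andP[].
have /andP[u0 _] := uT.
have := nbhd_set_ball (phiN u u0) close.
have AA : A l0 `<=` nbhd_set rho (A (lam (s + u))).
  apply: unifA => //; rewrite distrC.
  by have := osc u uT; rewrite lt_min => /andP[].
move=> /(nbhd_set_trans AA); apply: nbhd_set_le; lra.
Qed.

Lemma half_expn_small (R : realType) (a b : R) :
  0 < b -> exists k0 : nat, forall k, (k0 <= k)%N -> 2^-1 ^+ k * a <= b.
Proof.
move=> b0; have : 2^-1 ^+ k * a @[k --> \oo] --> (0 : R).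
  rewrite -(mul0r a); apply: cvgMr_tmp; apply: cvg_expr.
  by rewrite ger0_norm ?invr_ge0// invf_lt1// ltr1n.
move/cvgrPdist_le => /(_ _ b0)[k0 _ k0P]; exists k0 => k /k0P.
by rewrite sub0r normrN; exact: le_trans (ler_norm _).
Qed.

(** The conclusion at all window ends allows a restart at a later time with a smaller [rho]. In
    [5 * C + 2], the distance at a window end is eventually at most 5 rho, an incomplete window may
    multiply it by [C], and 2 rho is the error of that window. *)
Lemma nbhd_set_slow_decay (R : realType) (n : nat)
    (f : 'rV[R]_n * R -> 'rV[R]_n) (lm lp : R)
    (phi : R -> R -> 'rV[R]_n -> 'rV[R]_n) (A : R -> set 'rV[R]_n)
    (mu eta C T rho : R) :
  C1 f -> (forall l, lm <= l <= lp -> is_flow f l (phi l)) ->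
  branch_of_attractors phi A lm lp ->
  (forall l, lm <= l <= lp -> exp_stable_with (phi l) (A l) mu eta C) ->
  0 < T -> 0 <= mu -> 0 < C -> C * expR (- (mu * T)) <= 2^-1 ->
  0 < rho -> 4 * rho <= eta ->
  exists2 kappa, 0 < kappa & exists k0 : nat,
    forall (lam : R -> R) (y : R -> 'rV[R]_n) (s : R),
      (forall t, lm <= lam t <= lp) ->
      (forall t : R, is_derive t (1 : R) y (f (y t, lam t))) ->
      (forall t u, s <= t -> 0 <= u <= T -> `|lam (t + u) - lam t| < kappa) ->
      nbhd_set eta (A (lam s)) (y s) ->
      (forall k : nat, nbhd_set eta (A (lam (s + k%:R * T))) (y (s + k%:R * T))) /\
      (forall t, s + k0%:R * T <= t ->
         nbhd_set ((5 * C + 2) * rho) (A (lam t)) (y t)).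
Proof.
move=> C1f flow brA stab T0 mu0 C0 CT rho0 rhoeta.
have [kappa kappa0 step] :=
  nbhd_set_slow_window T C1f flow brA stab rho0.
exists kappa => //; have [k0 k0P] := half_expn_small (eta - 4 * rho) rho0.
exists k0 => lam y s lamI dy osc ys.
(* The solution of c_{k+1} = c_k / 2 + 2 rho with c_0 = eta; its fixed point is 4 rho. *)
pose c (k : nat) := 2^-1 ^+ k * (eta - 4 * rho) + 4 * rho.
have ceta k : c k <= eta.
  have : (2^-1 : R) ^+ k <= 1 by rewrite exprn_ile1 ?invr_ge0// invf_le1// ler1n.
  by rewrite /c; nra.
have c_ge0 k : 0 <= c k.
  by rewrite addr_ge0 ?mulr_ge0 ?exprn_ge0 ?invr_ge0// ?subr_ge0// ltW.
have sk (k : nat) : s <= s + k%:R * T by rewrite lerDl mulr_ge0// ltW.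
have yc (k : nat) : nbhd_set (c k) (A (lam (s + k%:R * T))) (y (s + k%:R * T)).
  elim: k => [|k IH]; first by rewrite /c expr0 mul1r subrK mul0r addr0.
  have := step lam y _ (c k) lamI dy (osc _ ^~ (sk k)) (ceta k) IH T.
  rewrite (ltW T0) lexx => /(_ isT).
  have -> : s + k.+1%:R * T = s + k%:R * T + T.
    by rewrite -natr1 mulrDl mul1r addrA.
  apply: nbhd_set_le.
  apply: (@le_trans _ _ (2^-1 * c k + 2 * rho)).
    by rewrite lerD2r ler_wpM2r.
  by rewrite /c exprS; lra.
split=> [k|t st]; first exact: nbhd_set_le (ceta k) _ (yc k).
have ts : k0%:R * T <= t - s by rewrite lerBrDl.
have ts0 : 0 <= (t - s) / T.
  by rewrite divr_ge0 ?(ltW T0)// (le_trans _ ts)// mulr_ge0// ltW.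
(* The window containing t has index [k], and [u] is the time elapsed in it. *)
pose k := Num.truncn ((t - s) / T); pose u := t - (s + k%:R * T).
have /andP[kt tk] := truncn_itv ts0.
have k0k : (k0 <= k)%N by rewrite truncn_ge_nat// ler_pdivlMr.
have uT : 0 <= u <= T.
  move: kt tk; rewrite -/k ler_pdivlMr// ltr_pdivrMr// -natr1 mulrDl mul1r /u.
  by move=> ? ?; apply/andP; split; lra.
have := step lam y _ (c k) lamI dy (osc _ ^~ (sk k)) (ceta k) (yc k) u uT.
rewrite subrKC; apply: nbhd_set_le.
have ck5 : c k <= 5 * rho by have := k0P k k0k; rewrite /c; lra.
have : C * expR (- (mu * u)) * c k <= C * (5 * rho).
  rewrite -mulrA ler_wpM2l ?(ltW C0)// -[leRHS]mul1r.
  rewrite ler_pM ?expR_ge0// -expR0 ler_expR oppr_le0.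
  by rewrite mulr_ge0//; case/andP: uT.
lra.
Qed.

(** * Uniform continuity of the parameter shift *)

Lemma parameter_shift_near_pinfty (R : realType) (Lam : R -> R) (lm lp e : R) :
  parameter_shift Lam lm lp -> 0 < e ->
  exists M, forall x, M < x -> `|Lam x - lp| < e.
Proof.
move=> [_ [_ [_ [/cvgrPdist_lt cvgp _]]]] /cvgp[M [_ MP]].
by exists M => x /MP; rewrite distrC.
Qed.

Lemma parameter_shift_near_ninfty (R : realType) (Lam : R -> R) (lm lp e : R) :
  parameter_shift Lam lm lp -> 0 < e ->
  exists M, forall x, x < M -> `|Lam x - lm| < e.
Proof.
move=> [_ [_ [/cvgrPdist_lt cvgm _]]] /cvgm[M [_ MP]].
by exists M => x /MP; rewrite distrC.
Qed.

(** The limits at both ends control the tails, a Lebesgue number the compact middle part. *)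
Lemma parameter_shift_uniformly_continuous (R : realType) (Lam : R -> R)
    (lm lp e : R) :
  parameter_shift Lam lm lp -> 0 < e -> exists2 d, 0 < d &
    forall x y, `|x - y| < d -> `|Lam x - Lam y| < e.
Proof.
move=> shiftL e0; have e20 : 0 < e / 2 by rewrite divr_gt0.
have [b bP] := parameter_shift_near_pinfty shiftL e20.
have [a aP] := parameter_shift_near_ninfty shiftL e20.
have mid (x y z : R) : `|x - z| < e / 2 -> `|y - z| < e / 2 -> `|x - y| < e.
  move=> xz yz; rewrite -(subrKA z) (le_lt_trans (ler_normD _ _))//.
  by rewrite [e]splitr ltrD// distrC.
have [|d d0 dP] := @segment_lebesgue_number R (a - 1) (b + 1)
    (fun x y => `|Lam x - Lam y| < e).
  move=> x _; have cL : {for x, continuous Lam}.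
    have [sm _] := shiftL; have := sm 0 x; rewrite derive1n0.
    by move=> /derivable1_diffP/differentiable_continuous.
  have /cvgrPdist_lt/(_ _ e20)/nbhs_ballP[d /= d0 dP] := cL.
  exists d => // y z _ _ yx zx; apply: (mid _ _ (Lam x)).
    by rewrite distrC; apply: dP; rewrite -ball_normE /= distrC.
  by rewrite distrC; apply: dP; rewrite -ball_normE /= distrC.
(* Points at distance below 1 that are not both in the same tail both lie in [a - 1, b + 1]; hence
   the enlarged segment. *)
exists (Num.min d 1); first by rewrite lt_min d0 ltr01.
move=> x y; rewrite lt_min => /andP[xyd]; rewrite ltr_norml => /andP[xy1 xy2].
have [/andP[bx bY]|nb] := boolP ((b < x) && (b < y)).
  by apply: (mid _ _ lp); exact: bP.
have [/andP[xa ya]|na] := boolP ((x < a) && (y < a)).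
  by apply: (mid _ _ lm); exact: aP.
move: nb na; rewrite !negb_and -!leNgt => nb na.
by apply: dP => //; case/orP: nb; case/orP: na => ? ?; apply/andP; split; lra.
Qed.

(** * Bounds for pullback fibres and limits; choice of the window length *)

Lemma pullback_fibre_sub (R : realType) (n : nat)
    (Phi : R -> R -> 'rV[R]_n -> 'rV[R]_n) (Am F : set 'rV[R]_n)
    (eta t S : R) :
  closed F -> (forall s x, s <= S -> nbhd_set eta Am x -> F (Phi t s x)) ->
  pullback_fibre Phi Am eta t `<=` F.
Proof.
move=> clF PhiF x /(_ (Num.max 1 (- S))) /=; rewrite lt_max ltr01 => /(_ isT) clx.
rewrite (closure_id F).1//; apply: closure_subset clx => _ [s /= sS [z Nz <-]].
apply: PhiF => //; rewrite (le_trans sS)//.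
by rewrite lerNl le_max lexx orbT.
Qed.

Lemma pullback_limit_sub (R : realType) (n : nat)
    (Phi : R -> R -> 'rV[R]_n -> 'rV[R]_n) (Am F : set 'rV[R]_n)
    (eta t0 : R) :
  closed F -> (forall t, t0 <= t -> pullback_fibre Phi Am eta t `<=` F) ->
  pullback_limit Phi Am eta `<=` F.
Proof.
move=> clF fibF x /(_ (Num.max 1 t0)) /=; rewrite lt_max ltr01 => /(_ isT) clx.
rewrite (closure_id F).1//; apply: closure_subset clx => z [t /= tt0].
by apply: fibF; rewrite (le_trans _ tt0)// le_max lexx orbT.
Qed.

(** With this [T] the claim reduces to exp(2 C) >= 2 C, a consequence of exp(x) >= 1 + x. *)
Lemma exists_contraction_time (R : realType) (mu C : R) :
  0 < mu -> 0 < C -> exists2 T, 0 < T & C * expR (- (mu * T)) <= 2^-1.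
Proof.
move=> mu0 C0; exists (2 * C / mu); first by rewrite divr_gt0// mulr_gt0.
rewrite (mulrC mu) divfK ?gt_eqF// expRN ler_pdivrMr ?expR_gt0//.
by have := expR_ge1Dx (2 * C); lra.
Qed.

(** * Closeness of the fibres to the branch, and tracking *)

Unset Implicit Arguments.

Theorem theorem3p1 (R : realType) (n : nat) (f : 'rV[R]_n * R -> 'rV[R]_n)
  (lm lp : R) (Lam : R -> R)
  (phi : R -> R -> 'rV[R]_n -> 'rV[R]_n)
  (Phi : R -> R -> R -> 'rV[R]_n -> 'rV[R]_n)
  (A : R -> set 'rV[R]_n) :
  C1 f -> lm < lp -> parameter_shift Lam lm lp ->
  (forall r, 0 < r -> is_cocycle f Lam r (Phi r)) ->
  (forall l, (lm <= l <= lp)%R -> is_flow f l (phi l)) ->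
  uniformly_stable_branch phi A lm lp ->
  exists2 eta0 : R, 0 < eta0 & forall eta : R, (0 < eta < eta0)%R ->
    (forall e : R, 0 < e -> exists2 d : R, 0 < d &
       forall r t : R, (0 < r < d)%R ->
         (dist (pullback_fibre (Phi r) (A lm) eta t) (A (Lam (r * t)%R)) < e%:E)%E) /\
    (exists2 d : R, 0 < d &
       forall r : R, (0 < r < d)%R -> pullback_limit (Phi r) (A lm) eta `<=` A lp).
Proof.
move=> C1f lmlp shiftL cocy flow [brA [mu [eta1 [C stab]]]].
have lmI : lm <= lm <= lp by rewrite lexx ltW.
have lpI : lm <= lp <= lp by rewrite lexx ltW.
have [mu0 [eta10 [C1 _]]] := stab _ lmI.
have C0 : 0 < C by rewrite (lt_le_trans _ C1).
exists eta1 => // eta /andP[eta0 etalt].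
have [T T0 CT] := exists_contraction_time mu0 C0.
have decay rho := nbhd_set_slow_decay (rho := rho) C1f flow brA stab T0 (ltW mu0) C0 CT.
pose lam r t := Lam (r * t).
have lamI r t : lm <= lam r t <= lp.
  by have [_ [/(_ (r * t))/andP[/ltW lt /ltW tl] _]] := shiftL; rewrite lt.
have slow kappa : 0 < kappa -> exists2 d, 0 < d & forall r t u, 0 < r < d ->
    0 <= u <= T -> `|lam r (t + u) - lam r t| < kappa.
  move=> /(parameter_shift_uniformly_continuous shiftL)[d d0 dP].
  exists (d / T); first by rewrite divr_gt0.
  move=> r t u /andP[r0 rd] /andP[u0 uT]; apply: dP.
  rewrite mulrDr addrAC subrr add0r ger0_norm ?mulr_ge0// ?ltW//.
  by rewrite (@le_lt_trans _ _ (r * T)) ?ler_wpM2l ?(ltW r0)// -ltr_pdivlMr.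
(* For very early s, [A lm] lies within eta1 - eta of [A (lam r s)], so points starting near [A lm]
   are in the uniform basin. This is why [eta] must be strictly below [eta1]. *)
have start r : 0 < r -> exists S, forall s x, s <= S -> nbhd_set eta (A lm) x ->
    nbhd_set eta1 (A (lam r s)) (Phi r s s x).
  move=> r0; have ee : 0 < eta1 - eta by rewrite subr_gt0.
  have [d d0 dA] := branch_uniformly_continuous brA ee.
  have [M MP] := parameter_shift_near_ninfty shiftL d0.
  exists ((M - 1) / r) => s x; rewrite ler_pdivlMr// mulrC => sM Nx.
  have [-> _] := cocy r r0 s x; rewrite -(subrKC eta eta1).
  apply: nbhd_set_trans Nx; apply: dA => //; rewrite distrC.
  by apply: MP; lra.
pose D := 5 * C + 2; have D0 : 0 < D by rewrite /D; lra.
(* The entries secure 4 rho <= eta1, required by [decay], and D rho <= e / 2. *)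
pose rho_ e := Num.min (eta1 / 4) (e / D / 2).
have rho_gt0 e : 0 < e -> 0 < rho_ e.
  by move=> e0; rewrite lt_min !divr_gt0.
have rho_le e : 4 * rho_ e <= eta1.
  have : rho_ e <= eta1 / 4 by rewrite ge_min lexx.
  lra.
have Drho e : D * rho_ e <= e / 2.
  have : rho_ e <= e / D / 2 by rewrite ge_min lexx orbT.
  move=> /(ler_wpM2l (ltW D0)) /le_trans; apply.
  by rewrite mulrA (mulrC D) divfK// gt_eqF.
split=> [e e0|].
  have [kappa kappa0 [k0 dec]] := decay _ (rho_gt0 e e0) (rho_le e).
  have [d d0 dP] := slow _ kappa0; exists d => // r t rd.
  have r0 : 0 < r by case/andP: rd.
  have [S SP] := start r r0.
  have fibN : pullback_fibre (Phi r) (A lm) eta t `<=`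
      [set x | forall d, D * rho_ e < d -> nbhd_set d (A (lam r t)) x].
    (* Starting before t - k0 T leaves time for [k0] full windows before t. *)
    apply: (pullback_fibre_sub (S := Num.min S (t - k0%:R * T))).
      exact: closed_dist_pt_le.
    move=> s x; rewrite le_min => /andP[sS st] Nx d' Dd'.
    have [_ /(_ t)] := dec (lam r) (fun u => Phi r u s x) s (lamI r) (cocy r r0 s x).2
      (fun t' u _ => dP r t' u rd) (SP s x sS Nx).
    by rewrite -lerBrDr => /(_ st); apply: nbhd_set_le; exact: ltW.
  (* The supremum yields only a non-strict bound, so a value strictly between D rho and e is
     inserted. *)
  apply: (@le_lt_trans _ _ (e / 2 + e / 4)%:E); last by rewrite lte_fin; lra.
  apply: ge_ereal_sup => _ [x /fibN Nx <-]; apply/ltW/Nx.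
  by have := Drho e; lra.
(* The threshold for r must not depend on the accuracy [e]. It is fixed with the coarsest admissible
   rho, just to keep solutions in the uniform basin at window ends; [e] enters only afterwards. *)
have rho00 : 0 < eta1 / 4 by rewrite divr_gt0.
have rho01 : 4 * (eta1 / 4) <= eta1 by lra.
have [kappa kappa0 [k0' dec0]] := decay _ rho00 rho01.
have [d d0 dP] := slow _ kappa0; exists d => // r rd x limx.
have r0 : 0 < r by case/andP: rd.
have [S SP] := start r r0.
apply: closed_nbhd_set0 => [|e e0].
  by apply: compact_closed => //; case: (brA.2 _ lpI) => [[_ []]].
have [kappa' kappa'0 [k0 dec]] := decay _ (rho_gt0 e e0) (rho_le e).
have k20 : 0 < kappa' / 2 by rewrite divr_gt0.
have [M MP] := parameter_shift_near_pinfty shiftL k20.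
have e40 : 0 < e / 4 by rewrite divr_gt0.
have [dA dA0 dAP] := branch_uniformly_continuous brA e40.
have [N NP] := parameter_shift_near_pinfty shiftL dA0.
(* From time [S1] on, [lam r] is within kappa' / 2 of [lp], so the finer oscillation bound holds for
   this fixed r. *)
pose S1 := (M + 1) / r.
have late t : S1 <= t -> M < r * t by rewrite ler_pdivrMr// mulrC; lra.
have osc t u : S1 <= t -> 0 <= u <= T -> `|lam r (t + u) - lam r t| < kappa'.
  move=> st /andP[u0 _]; rewrite -(subrKA lp) (le_lt_trans (ler_normD _ _))//.
  rewrite [kappa']splitr ltrD//; last rewrite distrC; apply: MP; apply: late => //.
  by rewrite (le_trans st)// lerDl.
have : pullback_limit (Phi r) (A lm) eta `<=`
    [set x | forall d, e / 2 + e / 4 < d -> nbhd_set d (A lp) x].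
  apply: (pullback_limit_sub (t0 := Num.max (S1 + T + k0%:R * T) ((N + 1) / r))).
    exact: closed_dist_pt_le.
  move=> t; rewrite ge_max => /andP[tS1 tN].
  apply: (pullback_fibre_sub (S := Num.min S S1)); first exact: closed_dist_pt_le.
  move=> s z; rewrite le_min => /andP[sS sS1] Nz d' ed'.
  have [pers _] := dec0 (lam r) (fun u => Phi r u s z) s (lamI r) (cocy r r0 s z).2
    (fun t' u _ => dP r t' u rd) (SP s z sS Nz).
  have q0 : 0 <= (S1 - s) / T by rewrite divr_ge0 ?subr_ge0// ltW.
  (* The successor makes s + k T the first window end after [S1], at most [S1 + T]. The fine decay
     restarts there, so the bound on t is independent of s. *)
  pose k := (Num.truncn ((S1 - s) / T)).+1.
  have /andP[] := truncn_itv q0; rewrite ler_pdivlMr// ltr_pdivrMr// => kS1 S1k.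
  have S1k' : S1 <= s + k%:R * T by rewrite -lerBlDl ltW.
  have kS1' : s + k%:R * T <= S1 + T.
    by rewrite /k -natr1 mulrDl mul1r addrA lerD2r -lerBrDl.
  have [_ /(_ t)] := dec (lam r) (fun u => Phi r u s z) (s + k%:R * T) (lamI r)
    (cocy r r0 s z).2 (fun t' u st' => osc t' u (le_trans S1k' st')) (pers k).
  have tk : s + k%:R * T + k0%:R * T <= t by rewrite (le_trans _ tS1)// lerD2r.
  move=> /(_ tk); have AA : A (lam r t) `<=` nbhd_set (e / 4) (A lp).
    apply: dAP => //; apply: NP.
    by move: tN; rewrite ler_pdivrMr// mulrC; lra.
  move=> /(nbhd_set_trans AA); apply: nbhd_set_le.
  by have := Drho e; rewrite /D; lra.
by move=> /(_ x limx); apply; lra.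
Qed.
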